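(* An algebra $\mathbf L=\langle L,\land,\lor,0,1\rangle$ is a bounded distributive bisemilattice if and only if it is isomorphic to a structure $\langle X,\cdot,+,\bot,\top\rangle$ of the following form: - $X$ is a family of sets closed under finite intersections with greatest element $\overline 1$; - $Y$ is a family of sets closed under finite unions with least element $\overline 0$; - $\theta:X\to Y$ is a bijection such that, for all $A,B,C\in X$, $A\cap\theta^{-1}(\theta(B)\cup\theta(C))=\theta^{-1}(\theta(A\cap B)\cup\theta(A\cap C))$, and, for all $P,Q,R\in Y$, $P\cup\theta(\theta^{-1}(Q)\cap\theta^{-1}(R))=\theta(\theta^{-1}(P\cup Q)\cap\theta^{-1}(P\cup R))$; - $A\cdot B=A\cap B$, $A+B=\theta^{-1}(\theta(A)\cup\theta(B))$, $\bot=\theta^{-1}(\overline0)$ and $\top=\overline1$.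
   Context: A bounded distributive bisemilattice is an algebra $\langle L,\land,\lor,0,1\rangle$ such that: - $\land$ and $\lor$ are idempotent, commutative and associative; - each of $\land$, $\lor$ distributes over the other; - $x\land1=x$ and $x\lor0=x$ for all $x$. *)

(* Defs.v *)
From mathcomp Require Import all_boot.
From mathcomp Require Import boolp classical_sets.

Set Implicit Arguments.
Unset Strict Implicit.
Unset Printing Implicit Defensive.

Local Open Scope classical_set_scope.

Record algebra := Algebra {
  carrier :> Type;
  meet : carrier -> carrier -> carrier;
  join : carrier -> carrier -> carrier;
  alg0 : carrier;
  alg1 : carrier
}.

Arguments alg0 {a}.
Arguments alg1 {a}.

(* Only right distributivity is listed: the left version follows by
   commutativity. *)
Record bounded_distributive_bisemilattice (L : algebra) : Prop := {
  meet_idem : idempotent_op (@meet L);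
  meet_comm : commutative (@meet L);
  meet_assoc : associative (@meet L);
  join_idem : idempotent_op (@join L);
  join_comm : commutative (@join L);
  join_assoc : associative (@join L);
  meet_join_distr : right_distributive (@meet L) (@join L);
  join_meet_distr : right_distributive (@join L) (@meet L);
  meet_one : right_id alg1 (@meet L);
  join_zero : right_id alg0 (@join L)
}.

Definition isomorphic (L M : algebra) : Prop :=
  exists f : L -> M,
    [/\ bijective f,
        {morph f : x y / meet x y >-> meet x y},
        {morph f : x y / join x y >-> join x y},
        f alg0 = alg0
      & f alg1 = alg1].

Definition capF (U : Type) (X : set (set U)) (hX : setI_closed X)
    (A B : X) : X :=
  exist _ (sval A `&` sval B)
    (mem_set (hX _ _ (set_mem (svalP A)) (set_mem (svalP B)))).

Definition cupF (V : Type) (Y : set (set V)) (hY : setU_closed Y)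
    (P Q : Y) : Y :=
  exist _ (sval P `|` sval Q)
    (mem_set (hY _ _ (set_mem (svalP P)) (set_mem (svalP Q)))).

(* famX and famY are families of subsets of possibly different ambient types.
   Closure is under binary, hence all nonempty finite, intersections (unions):
   the empty ones are not required to be setT (set0), since the bounds are only
   extremal for inclusion within the families. *)
Record set_structure := SetStructure {
  ptX : Type;
  ptY : Type;
  famX : set (set ptX);
  famY : set (set ptY);
  X_closed : setI_closed famX;
  Y_closed : setU_closed famY;
  topX : famX;
  topX_greatest : forall A : famX, sval A `<=` sval topX;
  botY : famY;
  botY_least : forall P : famY, sval botY `<=` sval P;
  theta : famX -> famY;
  thetaV : famY -> famX;
  thetaK : cancel theta thetaV;
  thetaVK : cancel thetaV theta;
  theta_cap : forall A B C : famX,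
    capF X_closed A (thetaV (cupF Y_closed (theta B) (theta C)))
    = thetaV (cupF Y_closed (theta (capF X_closed A B))
                            (theta (capF X_closed A C)));
  theta_cup : forall P Q R : famY,
    cupF Y_closed P (theta (capF X_closed (thetaV Q) (thetaV R)))
    = theta (capF X_closed (thetaV (cupF Y_closed P Q))
                           (thetaV (cupF Y_closed P R)))
}.

Arguments famX : clear implicits.
Arguments famY : clear implicits.
Arguments topX : clear implicits.
Arguments botY : clear implicits.

Definition set_algebra (S : set_structure) : algebra :=
  @Algebra (famX S)
    (fun A B => capF (@X_closed S) A B)
    (fun A B => thetaV (cupF (@Y_closed S) (theta A) (theta B)))
    (thetaV (botY S))
    (topX S).

(* Main.v *)
(** Order a bisemilattice in two ways: [x <= y] when [x /\ y = x], and
    [x <=' y] when [x \/ y = y]. The principal down-sets of the first order turn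
    meets into intersections; the complements of the principal up-sets of the
    second turn joins into unions. Both representations are injective, and theta
    matches the two sets representing the same element. *)
Require Import Defs.
From mathcomp Require Import all_boot.
From mathcomp Require Import boolp classical_sets.

Set Implicit Arguments.
Unset Strict Implicit.
Unset Printing Implicit Defensive.

Local Open Scope classical_set_scope.

Section CorestrictionToRange.
Variables (T U : Type) (f : T -> U).

Definition to_range (x : T) : range f :=
  exist _ (f x) (mem_set (imageT f x)).

(** The preimage is picked by choice; it inverts [to_range] on both sides once [f] is injective. *)
Definition of_range (A : range f) : T := sval (cid2 (set_mem (svalP A))).

Lemma of_rangeK : cancel of_range to_range.
Proof.
by move=> A; apply: val_inj; rewrite /= /of_range; case: cid2.
Qed.

Lemma to_rangeK : injective f -> cancel to_range of_range.
Proof. by move=> f_inj x; apply: f_inj; case: (of_rangeK (to_range x)). Qed.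

End CorestrictionToRange.

(** All the axioms are identities, so applying [f] to both sides reduces each one to its instance in
    [M]. *)
Lemma sub_bounded_distributive_bisemilattice (L M : algebra) (f : L -> M) :
  injective f ->
  {morph f : x y / meet x y >-> meet x y} ->
  {morph f : x y / join x y >-> join x y} ->
  f alg0 = alg0 -> f alg1 = alg1 ->
  bounded_distributive_bisemilattice M -> bounded_distributive_bisemilattice L.
Proof.
move=> f_inj fM fJ f0 f1 [mxx mC mA jxx jC jA mjD jmD m1 j0].
by split=> [x|x y|x y z|x|x y|x y z|x y z|x y z|x|x]; apply: f_inj;
  rewrite ?(fM, fJ, f0, f1).
Qed.

Lemma set_algebra_bounded_distributive_bisemilattice (S : set_structure) :
  bounded_distributive_bisemilattice (set_algebra S).
Proof.
split=> /=.
- by move=> A; apply: val_inj; rewrite /= setIid.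
- by move=> A B; apply: val_inj; rewrite /= setIC.
- by move=> A B C; apply: val_inj; rewrite /= setIA.
- move=> A /=; apply: (can_inj (@thetaK S)); rewrite thetaVK.
  by apply: val_inj; rewrite /= setUid.
- move=> A B /=; congr (thetaV _).
  by apply: val_inj; rewrite /= setUC.
- move=> A B C /=; congr (thetaV _); rewrite !thetaVK.
  by apply: val_inj; rewrite /= setUA.
- exact: theta_cap.
(* [theta_cup] is an equation in [famY]; taken at images of [theta] and simplified by [thetaK], it
   becomes the law in [famX]. *)
- move=> A B C /=; have := theta_cup (theta A) (theta B) (theta C).
  by rewrite !thetaK => ->; rewrite thetaK.
- by move=> A; apply: val_inj; apply/setIidPl; apply: topX_greatest.
- move=> A /=; apply: (can_inj (@thetaK S)); rewrite !thetaVK.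
  by apply: val_inj; apply/setUidPl; apply: botY_least.
Qed.

Section Representation.
Variables (L : algebra) (hL : bounded_distributive_bisemilattice L).
Implicit Types x y z : L.

Definition meet_downset x : set L := [set z | meet z x = z].
Definition join_coupset x : set L := [set z | join x z <> z].

(** The meet is the greatest lower bound for [<=]. *)
Lemma meet_downsetI x y :
  meet_downset (meet x y) = meet_downset x `&` meet_downset y.
Proof.
have [mxx mC mA _ _ _ _ _ _ _] := hL.
apply/seteqP; split=> z /=; last by case=> zx zy; rewrite /meet_downset /= mA zx.
rewrite /meet_downset /= => zxy; split; rewrite -zxy.
  by rewrite -mA (mC _ x) (mA x x) mxx.
by rewrite -2!mA mxx.
Qed.

(** The join is the least upper bound for [<='], so up-sets intersect and, by De Morgan, their
    complements unite. *)
Lemma join_coupsetU x y :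
  join_coupset (join x y) = join_coupset x `|` join_coupset y.
Proof.
have [_ _ _ jxx jC jA _ _ _ _] := hL.
apply/seteqP; split=> z; rewrite /join_coupset /=.
  move=> xyz; have [xz|] := pselect (join x z = z); last by left.
  by right=> yz; apply: xyz; rewrite -jA yz.
move=> xz_yz xyz; case: xz_yz; apply; rewrite -xyz.
  by rewrite !jA jxx.
by rewrite !jA (jC y) -(jA x) jxx.
Qed.

(** By idempotence each element lies in its own down-set, so equal down-sets give [x <= y] and
    [y <= x]; antisymmetry is commutativity. *)
Lemma meet_downset_inj : injective meet_downset.
Proof.
have [mxx mC _ _ _ _ _ _ _ _] := hL.
move=> x y xy.
have xy' : meet_downset y x by rewrite -xy; exact: mxx.
have yx : meet_downset x y by rewrite xy; exact: mxx.
by rewrite -xy' mC yx.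
Qed.

Lemma join_coupset_inj : injective join_coupset.
Proof.
have [_ _ _ jxx jC _ _ _ _ _] := hL.
move=> x y xy.
have yx : join y x = x.
  (* Otherwise [x] would lie in the set of [y], hence in its own, which idempotence forbids. *)
  apply: contrapT => yx; suff : join_coupset x x by apply; exact: jxx.
  by rewrite xy.
have xy' : join x y = y.
  apply: contrapT => xy'; suff : join_coupset y y by apply; exact: jxx.
  by rewrite -xy.
by rewrite -yx jC xy'.
Qed.

Let X := range meet_downset.
Let Y := range join_coupset.

Lemma meet_downsets_closed : setI_closed X.
Proof.
move=> _ _ [x _ <-] [y _ <-]; rewrite -meet_downsetI; exact: imageT.
Qed.

Lemma join_coupsets_closed : setU_closed Y.
Proof.
move=> _ _ [x _ <-] [y _ <-]; rewrite -join_coupsetU; exact: imageT.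
Qed.

Let inX x : X := to_range meet_downset x.
Let inY x : Y := to_range join_coupset x.
Let outX (A : X) : L := of_range A.
Let outY (P : Y) : L := of_range P.

Let inXK : cancel inX outX := to_rangeK meet_downset_inj.
Let inYK : cancel inY outY := to_rangeK join_coupset_inj.
Let outXK : cancel outX inX := @of_rangeK _ _ meet_downset.
Let outYK : cancel outY inY := @of_rangeK _ _ join_coupset.

Let inXI x y : capF meet_downsets_closed (inX x) (inX y) = inX (meet x y).
Proof. by apply: val_inj; rewrite /= meet_downsetI. Qed.

Let inYU x y : cupF join_coupsets_closed (inY x) (inY y) = inY (join x y).
Proof. by apply: val_inj; rewrite /= join_coupsetU. Qed.

Let th (A : X) : Y := inY (outX A).
Let thV (P : Y) : X := inX (outY P).

Let thK : cancel th thV.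
Proof. by move=> A; rewrite /thV /th inYK outXK. Qed.

Let thVK : cancel thV th.
Proof. by move=> P; rewrite /thV /th inXK outYK. Qed.

Let th_in x : th (inX x) = inY x. Proof. by rewrite /th inXK. Qed.
Let thV_in x : thV (inY x) = inX x. Proof. by rewrite /thV inYK. Qed.

(** The down-set of [alg1] is all of [L]. *)
Let top_greatest (A : X) : sval A `<=` sval (inX alg1).
Proof. by move=> z _; exact: meet_one hL z. Qed.

(** The set attached to [alg0] is empty, as [alg0] is least for [<=']. *)
Let bot_least (P : Y) : sval (inY alg0) `<=` sval P.
Proof. by move=> z /= []; rewrite (join_comm hL); exact: join_zero hL z. Qed.

Let th_cap (A B C : X) :
  capF meet_downsets_closed A (thV (cupF join_coupsets_closed (th B) (th C)))
  = thV (cupF join_coupsets_closed (th (capF meet_downsets_closed A B))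
                                   (th (capF meet_downsets_closed A C))).
Proof.
(* Once every set is written as the image of an element, both sides are computed in [L], where the
   condition is distributivity of [meet] over [join]. *)
rewrite -(outXK A) -(outXK B) -(outXK C).
by rewrite !(th_in, inXI, inYU, thV_in) (meet_join_distr hL).
Qed.

Let th_cup (P Q R : Y) :
  cupF join_coupsets_closed P (th (capF meet_downsets_closed (thV Q) (thV R)))
  = th (capF meet_downsets_closed (thV (cupF join_coupsets_closed P Q))
                                  (thV (cupF join_coupsets_closed P R))).
Proof.
rewrite -(outYK P) -(outYK Q) -(outYK R).
by rewrite !(th_in, inXI, inYU, thV_in) (join_meet_distr hL).
Qed.

Definition representation : set_structure :=
  SetStructure top_greatest bot_least thK thVK th_cap th_cup.

Lemma isomorphic_representation : isomorphic L (set_algebra representation).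
Proof.
exists inX; split => /=.
- by exists outX; [exact: inXK | exact: outXK].
- by move=> x y /=; rewrite inXI.
(* The join passes through [Y]: the union of [inY x] and [inY y] is [inY (join x y)], which [thV]
   sends back to [X]. *)
- by move=> x y /=; rewrite !th_in inYU thV_in.
- by rewrite thV_in.
- by [].
Qed.

End Representation.

Theorem theorem4p5 (L : algebra) :
  bounded_distributive_bisemilattice L <->
  exists S : set_structure, isomorphic L (set_algebra S).
Proof.
split=> [hL|[S [f [f_bij fM fJ f0 f1]]]].
  by exists (representation hL); exact: isomorphic_representation.
apply: (sub_bounded_distributive_bisemilattice (bij_inj f_bij) fM fJ f0 f1).
exact: set_algebra_bounded_distributive_bisemilattice.
Qed.
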